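(* Let $X$ be a uniformly convex real Banach space and let $\alpha_1,\dots,\alpha_m\in(0,1)$ be constants with $\sum_{i=1}^m\alpha_i=1$. Suppose $\{z_{in}\}_{n=1}^\infty$, $i=1,\dots,m$, are sequences in $X$ such that for some $d\ge0$ $$\lim_{n\to\infty}\left\|\sum_{i=1}^m\alpha_iz_{in}\right\|=d,\qquad \limsup_{n\to\infty}\|z_{in}\|\le d\quad\text{for all } i=1,\dots,m.$$ Then $\lim_{n\to\infty}\|z_{in}\|=d$ and $\lim_{n\to\infty}\|z_{in}-z_{jn}\|=0$ for all $i,j\in\{1,\dots,m\}$. *)

(* Defs.v *)
From HB Require Import structures.
From mathcomp Require Import all_boot all_order all_algebra.
From mathcomp Require Import all_classical all_reals all_analysis.
Set Implicit Arguments.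
Unset Strict Implicit.
Unset Printing Implicit Defensive.
Import Order.TTheory GRing.Theory Num.Theory.
Import numFieldNormedType.Exports.
Local Open Scope ring_scope.

(* Clarkson's definition, with x and y on the unit sphere. *)
Definition uniformly_convex (R : realType) (X : normedModType R) : Prop :=
  forall eps : R, 0 < eps -> eps <= 2 ->
  exists2 delta : R, 0 < delta &
    forall x y : X, `|x| = 1 -> `|y| = 1 -> eps <= `|x - y| ->
      `|2^-1 *: (x + y)| <= 1 - delta.

(* Main.v *)
(* With a = min(alpha_i, alpha_j)/2 all coefficients of
   sum_k alpha_k z_k - a (z_i + z_j) are nonnegative and sum to 1 - 2a, so
   |sum_k alpha_k z_k| <= a |z_i + z_j| + (1 - 2a) max_k |z_k|.  Hence
   liminf |z_in + z_jn| >= 2d.  The case i = j gives |z_in| --> d, and for the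
   other pairs uniform convexity on a neighbourhood of the sphere of radius d
   forces |z_in - z_jn| --> 0. *)
Require Import Defs.
From HB Require Import structures.
From mathcomp Require Import all_boot all_order all_algebra.
From mathcomp Require Import all_classical all_reals all_analysis.
From mathcomp Require Import ring lra.
Import Order.TTheory GRing.Theory Num.Theory.
Import numFieldNormedType.Exports.
Local Open Scope classical_set_scope.
Local Open Scope ring_scope.

Lemma norm_convex_comb_le (R : realType) (X : normedModType R) (m : nat)
    (alpha : 'I_m -> R) (z : 'I_m -> X) (i j : 'I_m) (a c : R) :
  (forall k, 0 <= alpha k) -> \sum_(k < m) alpha k = 1 ->
  0 <= a -> 2 * a <= alpha i -> 2 * a <= alpha j ->
  (forall k, `|z k| <= c) ->
  `|\sum_(k < m) alpha k *: z k| <= a * `|z i + z j| + (1 - 2 * a) * c.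
Proof.
move=> alpha0 alpha1 a0 ai aj zc.
pose b k := alpha k - (k == i)%:R * a - (k == j)%:R * a.
have pick_sum l : \sum_(k < m) (k == l)%:R * a = a.
  rewrite (bigD1 l) //= eqxx mul1r big1 ?addr0// => k /negPf ->.
  by rewrite mul0r.
have pick_vec l : \sum_(k < m) ((k == l)%:R * a) *: z k = a *: z l.
  rewrite (bigD1 l) //= eqxx mul1r big1 ?addr0// => k /negPf ->.
  by rewrite mul0r scale0r.
(* The case [i = j] is allowed; there [2 * a] is taken off a single coefficient, which is what
   [2 * a <= alpha i] pays for. *)
have b0 k : 0 <= b k.
  rewrite /b; have := alpha0 k.
  by case: eqP => [->|_]; case: eqP => [?|_]; subst; rewrite /=; lra.
have b1 : \sum_(k < m) b k = 1 - 2 * a.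
  by rewrite !sumrB !pick_sum alpha1; lra.
have -> : \sum_(k < m) alpha k *: z k
    = a *: (z i + z j) + \sum_(k < m) b k *: z k.
  under [in RHS]eq_bigr do rewrite !scalerBl.
  rewrite !sumrB !pick_vec scalerDr.
  by rewrite [a *: z i + _]addrC [RHS]addrC addrA !subrK.
apply: (le_trans (ler_normD _ _)); rewrite normrZ ger0_norm// lerD2l.
apply: (le_trans (ler_norm_sum _ _ _)); rewrite -b1 mulr_suml.
by apply: ler_sum => k _; rewrite normrZ ger0_norm// ler_wpM2l.
Qed.

(** For [d > 0], rescaling [x] and [y] to unit vectors [u] and [v] costs little, since [d *: u] and
    [d *: v] lie within [e] of them. If [u] and [v] were far apart, uniform convexity would make
    [x + y] too short. For [d = 0] both vectors are small and the triangle inequality is enough. *)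
Lemma uniformly_convex_near_sphere (R : realType) (X : normedModType R)
    (d eps : R) :
  uniformly_convex X -> 0 <= d -> 0 < eps ->
  exists2 e : R, 0 < e & forall x y : X,
    `|d - `|x| | <= e -> `|d - `|y| | <= e -> 2 * d - e <= `|x + y| ->
    `|x - y| <= eps.
Proof.
move=> uc; rewrite le_eqVlt => /predU1P[<- eps0|d0 eps0].
  exists (eps / 2) => [|x y]; first lra.
  rewrite !sub0r !normrN !normr_id => xe ye _.
  by apply: (le_trans (ler_normB _ _)); lra.
(* The cap 2 keeps [t] in the range of [uniformly_convex]; the other bound gives
   [d * t <= eps / 2]. *)
pose t := Num.min 2 (eps / (2 * d)).
have t0 : 0 < t by rewrite lt_min ltr0n divr_gt0//; lra.
have [|delta delta0 ucd] := uc _ t0; first by rewrite ge_min lexx.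
have dt : d * t <= eps / 2.
  have -> : eps / 2 = d * (eps / (2 * d)) by field; lra.
  by rewrite ler_pM2l// ge_min lexx orbT.
have dd : 0 < d * delta by rewrite mulr_gt0.
(* The three bounds keep [x] and [y] away from 0, give [3 * e < 2 * d * delta] for the
   contradiction, and give [d * t + 2 * e <= eps]. *)
pose e := Num.min (d / 2) (Num.min (d * delta / 2) (eps / 4)).
have e0 : 0 < e by rewrite !lt_min; lra.
have ed : e <= d / 2 by rewrite ge_min lexx.
have edd : e <= d * delta / 2 by rewrite !ge_min lexx orbT.
have ee : e <= eps / 4 by rewrite !ge_min lexx !orbT.
exists e => // x y xe ye xy.
have proj (w : X) : `|d - `|w| | <= e ->
    `| `|w|^-1 *: w| = 1 /\ `|d *: (`|w|^-1 *: w) - w| <= e.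
  move=> we.
  have w0 : 0 < `|w| by move: we; rewrite ler_norml => /andP[]; lra.
  split; first by rewrite normrZ ger0_norm ?invr_ge0// mulVf// gt_eqF.
  rewrite scalerA -[X in _ - X]scale1r -scalerBl normrZ.
  rewrite -[X in _ * X](ger0_norm (ltW w0)) -normrM mulrBl mul1r.
  by rewrite divfK ?gt_eqF.
have [u1 ue] := proj _ xe; have [v1 ve] := proj _ ye.
set u := `|x|^-1 *: x in u1 ue; set v := `|y|^-1 *: y in v1 ve.
(* If [u] and [v] are at least [t] apart, then [|x + y| <= 2 * d - 2 * d * delta + 2 * e < 2 * d -
   e], a contradiction. *)
have [tuv|/ltW uvt] := leP t `|u - v|.
  have := ucd u v u1 v1 tuv.
  rewrite normrZ ger0_norm ?invr_ge0// => uv.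
  have : `|x + y| <= d * `|u + v| + (e + e).
    have -> : x + y = d *: (u + v) - ((d *: u - x) + (d *: v - y)).
      by rewrite scalerDr addrACA -opprD opprB [RHS]addrC subrK.
    apply: (le_trans (ler_normB _ _)); rewrite normrZ gtr0_norm// lerD2l.
    by apply: (le_trans (ler_normD _ _)); rewrite lerD.
  have : d * `|u + v| <= d * (2 - 2 * delta) by rewrite ler_pM2l//; lra.
  lra.
have -> : x - y = d *: (u - v) - ((d *: u - x) - (d *: v - y)).
  by rewrite scalerBr [- (_ - y)]opprD addrACA -opprD opprB [RHS]addrC subrK.
apply: (le_trans (ler_normB _ _)); rewrite normrZ gtr0_norm//.
have : `|(d *: u - x) - (d *: v - y)| <= e + e.
  by apply: (le_trans (ler_normB _ _)); rewrite lerD.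
have : d * `|u - v| <= d * t by rewrite ler_pM2l.
lra.
Qed.

(** The limsup is an infimum of suprema over sets of the filter [\oo]; as it lies below [d + e], so
    does one of these suprema. *)
Lemma limn_esup_le_near (R : realType) (u : nat -> R) (d e : R) :
  (limn_esup (fun n => (u n)%:E) <= d%:E)%E -> 0 < e ->
  \forall n \near \oo, u n <= d + e.
Proof.
move=> ud e0.
have : (limn_esup (fun n => (u n)%:E) < (d + e)%:E)%E.
  by apply: (le_lt_trans ud); rewrite lte_fin ltrDl.
move=> /ereal_inf_lt[_ [A FA <-]] supA.
near=> n; rewrite -lee_fin; apply: le_trans (ltW supA).
apply: ereal_sup_ubound; exists n => //; near: n; exact: FA.
Unshelve. all: by end_near. Qed.

Theorem lemma3p1 (R : realType) (X : completeNormedModType R)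
    (hX : uniformly_convex X)
    (m : nat) (alpha : 'I_m -> R)
    (halpha : forall i : 'I_m, 0 < alpha i < 1)
    (hsum : \sum_(i < m) alpha i = 1)
    (z : 'I_m -> nat -> X) (d : R) (hd : 0 <= d)
    (hlim : `|\sum_(i < m) alpha i *: z i n| @[n --> \oo] --> d)
    (hlimsup : forall i : 'I_m,
      (limn_esup (fun n : nat => (`|z i n|)%:E) <= d%:E)%E) :
  (forall i : 'I_m, `|z i n| @[n --> \oo] --> d) /\
  (forall i j : 'I_m, `|z i n - z j n| @[n --> \oo] --> (0 : R)).
Proof.
have znear e : 0 < e -> \forall n \near \oo, forall k, `|z k n| <= d + e.
  by move=> e0; apply: filter_forall => k; exact: limn_esup_le_near.
have sum_ge i j e : 0 < e -> \forall n \near \oo, 2 * d - e <= `|z i n + z j n|.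
  move=> e0; have /andP[ai0 _] := halpha i; have /andP[aj0 _] := halpha j.
  pose a := Num.min (alpha i) (alpha j) / 2.
  have a0 : 0 < a by rewrite divr_gt0// lt_min ai0.
  have ai : 2 * a <= alpha i by rewrite /a mulrC divfK// ge_min lexx.
  have aj : 2 * a <= alpha j by rewrite /a mulrC divfK// ge_min lexx orbT.
  (* With this tolerance for both the sum and the norms, [a * |z i n + z j n|] is at least
     [a * (2 * d - e)] plus the nonnegative [2 * a * (a * e / 2)]. *)
  have ae0 : 0 < a * e / 2 by rewrite divr_gt0// mulr_gt0.
  near=> n.
  have zc : forall k, `|z k n| <= d + a * e / 2 by near: n; exact: znear.
  have : `|d - `|\sum_(k < m) alpha k *: z k n| | <= a * e / 2.
    by near: n; exact: (cvgrPdist_le _ _).1 hlim _ ae0.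
  rewrite ler_norml => /andP[_ dS].
  have := @norm_convex_comb_le _ _ _ alpha (z ^~ n) i j a _
    (fun k => ltW (andP (halpha k)).1) hsum (ltW a0) ai aj zc.
  move=> /= Sle; rewrite -(ler_pM2l a0).
  have : 0 <= 2 * a * (a * e / 2) by apply: mulr_ge0; lra.
  lra.
have cvz i : `|z i n| @[n --> \oo] --> d.
  apply/cvgrPdist_le => e e0; near=> n.
  (* The diagonal case bounds [2 * |z i n|] from below by [2 * d - e]. *)
  have : 2 * d - e <= `|z i n + z i n| by near: n; exact: sum_ge.
  have : forall k, `|z k n| <= d + e by near: n; exact: znear.
  move=> /(_ i); have := ler_normD (z i n) (z i n).
  by rewrite ler_norml; lra.
split=> // i j; apply/cvgrPdist_le => eps eps0.
have [e e0 He] := @uniformly_convex_near_sphere _ _ _ _ hX hd eps0.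
near=> n; rewrite sub0r normrN normr_id; apply: He.
- by near: n; exact: (cvgrPdist_le _ _).1 (cvz i) _ e0.
- by near: n; exact: (cvgrPdist_le _ _).1 (cvz j) _ e0.
- by near: n; exact: sum_ge.
Unshelve. all: by end_near. Qed.
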